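(* Let $X$ and $Y$ be independent real-valued random variables with joint probability density function $f_{X,Y}$, marginal densities $f_X,f_Y$, marginal cumulative distribution functions $F_X,F_Y$ and joint cumulative distribution function $F_{X,Y}$. Let $f_{IX,IY}(x,y)=-\tfrac12 f_{X,Y}(x,y)\log F_{X,Y}(x,y)$ be their joint information-weighted density, and let $f_{IX}(x)=-f_X(x)\log F_X(x)$, $f_{IY}(y)=-f_Y(y)\log F_Y(y)$. Then $$f_{IX,IY}(x,y)=\tfrac12\bigl[f_Y(y)\,f_{IX}(x)+f_X(x)\,f_{IY}(y)\bigr].$$
   Context: $F_{X,Y}(x,y)=P(X\le x,\,Y\le y)$; densities are with respect to Lebesgue measure, with $f_{X,Y}(x,y)=f_X(x)f_Y(y)$ by independence, and $\log$ is the natural logarithm. $f_{IX}$ and $f_{IY}$ are the information-weighted densities of $X$ and $Y$. Each weighted density is taken to be $0$ at points where the corresponding cumulative distribution function vanishes (identities between densities are understood almost everywhere). *)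

(* Defs.v *)
From HB Require Import structures.
From mathcomp Require Import all_boot all_order all_algebra.
From mathcomp Require Import all_classical all_reals all_analysis.

Set Implicit Arguments.
Unset Strict Implicit.
Unset Printing Implicit Defensive.

Import Order.TTheory GRing.Theory Num.Theory.
Import numFieldNormedType.Exports.

Local Open Scope classical_set_scope.
Local Open Scope ring_scope.

Definition is_density d (T : measurableType d) (R : realType)
    (mu : {measure set T -> \bar R}) (nu : set T -> \bar R) (f : T -> R) : Prop :=
  [/\ measurable_fun [set: T] f,
      forall x, 0 <= f x &
      forall A, measurable A -> nu A = (\int[mu]_(x in A) (f x)%:E)%E].

Section random_pair.
Context d (T : measurableType d) (R : realType) (P : probability T R).

Definition lebesgue_measure2 :
    {measure set (measurableTypeR R * measurableTypeR R) -> \bar R} :=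
  (@lebesgue_measure R \x @lebesgue_measure R)%E.

Definition independent_RV (X Y : {RV P >-> R}) : Prop :=
  forall A B : set R, measurable A -> measurable B ->
    P ((X @^-1` A) `&` (Y @^-1` B)) = (P (X @^-1` A) * P (Y @^-1` B))%E.

Definition has_density (X : {RV P >-> R}) (f : R -> R) : Prop :=
  is_density (@lebesgue_measure R) (distribution P X) f.

Definition has_joint_density (X Y : {RV P >-> R}) (f : R * R -> R) : Prop :=
  is_density lebesgue_measure2 (pushforward P (fun w => (X w, Y w))) f.

(* The library's [cdf] takes values in the extended reals. *)
Definition cdfR (X : {RV P >-> R}) (x : R) : R := fine (cdf X x).

Definition joint_cdf (X Y : {RV P >-> R}) (z : R * R) : R :=
  fine (P [set w | X w <= z.1 /\ Y w <= z.2]).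

(* Weighted densities are 0, by convention, where the corresponding
   cumulative distribution function vanishes. *)
Definition iw_density (X : {RV P >-> R}) (f : R -> R) (x : R) : R :=
  if cdfR X x == 0 then 0 else - f x * ln (cdfR X x).

Definition joint_iw_density (X Y : {RV P >-> R}) (f : R * R -> R)
    (z : R * R) : R :=
  if joint_cdf X Y z == 0 then 0
  else - 2^-1 * f z * ln (joint_cdf X Y z).

End random_pair.

Arguments lebesgue_measure2 : clear implicits.

(* Main.v *)
(* By uniqueness of product measures, independence makes f_X(x) f_Y(y) a density
   of the law of (X, Y), so it agrees a.e. with f_{X,Y}, while F_{X,Y}(x, y) =
   F_X(x) F_Y(y) and log turns the product into a sum. The only delicate points
   are those where F_X or F_Y vanishes: the set {F_X = 0} has probability zero
   under the law of X, so f_X = 0 a.e. on it and both sides are 0 there. *)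
Require Import Defs.
From HB Require Import structures.
From mathcomp Require Import all_boot all_order all_algebra.
From mathcomp Require Import all_classical all_reals all_analysis.
From mathcomp Require Import measurable_realfun ring.

Set Implicit Arguments.
Unset Strict Implicit.
Unset Printing Implicit Defensive.

Import Order.TTheory GRing.Theory Num.Theory.
Import numFieldNormedType.Exports.

Local Open Scope classical_set_scope.
Local Open Scope ring_scope.

Section density_measure.
Context d (T : measurableType d) (R : realType) (mu : {measure set T -> \bar R}).
Variables (f : T -> \bar R) (mf : measurable_fun [set: T] f).
Hypothesis f0 : forall x, (0 <= f x)%E.

(* The hypotheses are arguments so that the measure instance can be inferred. *)
Definition density_measure of measurable_fun [set: T] f &
  (forall x, 0 <= f x)%E : set T -> \bar R := fun A => (\int[mu]_(x in A) f x)%E.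

Local Notation nu := (density_measure mf f0).

Let density_measure0 : nu set0 = 0%E.
Proof. exact: integral_set0. Qed.

Let density_measure_ge0 A : (0 <= nu A)%E.
Proof. exact: integral_ge0. Qed.

Let density_measure_sigma_additive : semi_sigma_additive nu.
Proof. exact: semi_sigma_additive_nng_induced. Qed.

HB.instance Definition _ := isMeasure.Build _ _ _ nu
  density_measure0 density_measure_ge0 density_measure_sigma_additive.

End density_measure.

Lemma measurable_fun_tensor d1 d2 (T1 : measurableType d1)
    (T2 : measurableType d2) (R : realType) (f : T1 -> R) (g : T2 -> R) :
  measurable_fun [set: T1] f -> measurable_fun [set: T2] g ->
  measurable_fun [set: T1 * T2] (fun z => f z.1 * g z.2).
Proof.
move=> mf mg; apply: measurable_funM.
- exact: measurableT_comp mf measurable_fst.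
- exact: measurableT_comp mg measurable_snd.
Qed.

(** Tonelli: on a rectangle the inner integral is [f x] times a constant. This evaluates the tensor
    density on rectangles, the sets that determine a product measure. *)
Lemma ge0_integral_setX d1 d2 (T1 : measurableType d1) (T2 : measurableType d2)
    (R : realType) (m1 : {sigma_finite_measure set T1 -> \bar R})
    (m2 : {sigma_finite_measure set T2 -> \bar R})
    (f : T1 -> R) (g : T2 -> R) (A : set T1) (B : set T2) :
  measurable A -> measurable B ->
  measurable_fun [set: T1] f -> measurable_fun [set: T2] g ->
  (forall x, 0 <= f x) -> (forall y, 0 <= g y) ->
  (\int[m1 \x m2]_(z in A `*` B) (f z.1 * g z.2)%:E =
   \int[m1]_(x in A) (f x)%:E * \int[m2]_(y in B) (g y)%:E)%E.
Proof.
move=> mA mB mf mg f0 g0.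
have mfg : measurable_fun [set: T1 * T2] (fun z => (f z.1 * g z.2)%:E).
  by apply/measurable_EFinP; exact: measurable_fun_tensor.
(* Integrands are extended by zero, so that Tonelli applies on the whole space. *)
rewrite integral_mkcond fubini_tonelli1; last 2 first.
- apply/measurable_restrict => //; first exact: measurableX.
  exact: measurable_funS mfg.
- by apply: erestrict_ge0 => z _; rewrite lee_fin mulr_ge0.
rewrite [X in (X * _)%E]integral_mkcond -ge0_integralZr//; last 3 first.
- apply/measurable_restrict => //.
  apply: measurable_funS measurableT _ _ => //.
  exact/measurable_EFinP.
- by move=> x _; apply: erestrict_ge0 => y _; rewrite lee_fin.
- by apply: integral_ge0 => y _; rewrite lee_fin.
apply: eq_integral => x _; rewrite /fubini_F patchE.
(* The section of [A]*[B] at [x] is empty for [x] outside [A], and [B] otherwise. *)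
case: ifPn => xA; last first.
  rewrite mul0e integral0_eq// => y _; rewrite patchE ifF//.
  by apply/negbTE; apply: contra xA; rewrite !inE => -[].
rewrite -ge0_integralZl_EFin//; last 2 first.
- by move=> y _; rewrite lee_fin.
- by apply/measurable_EFinP; exact: measurable_funS mg.
rewrite [RHS]integral_mkcond; apply: eq_integral => y _; rewrite !patchE.
suff -> : ((x, y) \in A `*` B) = (y \in B) by [].
by move: xA; rewrite inE => xA; apply/idP/idP; rewrite !inE => // -[].
Qed.

Lemma is_density_prod d1 d2 (T1 : measurableType d1) (T2 : measurableType d2)
    (R : realType) (m1 n1 : {sigma_finite_measure set T1 -> \bar R})
    (m2 n2 : {sigma_finite_measure set T2 -> \bar R}) (f : T1 -> R) (g : T2 -> R) :
  is_density m1 n1 f -> is_density m2 n2 g ->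
  is_density (m1 \x m2)%E (n1 \x n2)%E (fun z => f z.1 * g z.2).
Proof.
move=> [mf f0 n1E] [mg g0 n2E].
have mfg : measurable_fun [set: T1 * T2] (fun z => f z.1 * g z.2).
  exact: measurable_fun_tensor.
have fg0 z : 0 <= f z.1 * g z.2 by rewrite mulr_ge0.
split=> // C mC.
have mfgE : measurable_fun [set: T1 * T2] (fun z => (f z.1 * g z.2)%:E).
  exact/measurable_EFinP.
have fgE0 z : (0 <= (f z.1 * g z.2)%:E :> \bar R)%E by rewrite lee_fin.
(* The measure with density [f z.1 * g z.2] agrees with [n1 \x n2] on rectangles, hence
   everywhere. *)
rewrite (@product_measure_unique _ _ _ _ _ n1 n2
  (density_measure (m1 \x m2)%E mfgE fgE0))// => A B mA mB.
by rewrite n1E// n2E// -ge0_integral_setX.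
Qed.

(** Finite total mass makes the densities integrable, and integrals over all measurable sets
    determine an integrable function a.e. Two set functions are allowed because equality is only
    asked on measurable sets. *)
Lemma is_density_ae_eq d (T : measurableType d) (R : realType)
    (mu : {measure set T -> \bar R}) (nu1 nu2 : set T -> \bar R) (f g : T -> R) :
  (nu1 [set: T] < +oo)%E -> (forall A, measurable A -> nu1 A = nu2 A) ->
  is_density mu nu1 f -> is_density mu nu2 g -> {ae mu, forall x, f x = g x}.
Proof.
move=> nu1oo nu12 [mf f0 nu1E] [mg g0 nu2E].
have : ae_eq mu setT (EFin \o f) (EFin \o g).
  apply: integral_ae_eq => //; last 2 first.
  - exact/measurable_EFinP.
  - by move=> E _ mE; rewrite -nu1E// -nu2E// nu12.
  apply/integrableP; split; first exact/measurable_EFinP.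
  rewrite (eq_integral (EFin \o f)) ?nu1E// -?nu1E// => x _ /=.
  by rewrite ger0_norm.
by apply: filterS => x /(_ I) [].
Qed.

(** Independence is agreement of the two laws on rectangles; uniqueness of product measures extends
    it to all measurable sets. *)
Lemma pushforward_pair_prod d d1 d2 (T : measurableType d)
    (T1 : measurableType d1) (T2 : measurableType d2) (R : realType)
    (P : probability T R) (X : {mfun T >-> T1}) (Y : {mfun T >-> T2}) :
  (forall A B, measurable A -> measurable B ->
    P (X @^-1` A `&` Y @^-1` B) = P (X @^-1` A) * P (Y @^-1` B))%E ->
  forall C, measurable C ->
  (distribution P X \x distribution P Y)%E C =
  pushforward P (fun w => (X w, Y w)) C.
Proof.
move=> XY C mC.
have mXY : measurable_fun [set: T] (fun w => (X w, Y w)).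
  by apply/measurable_fun_pairP; split; exact: measurable_funP.
apply: (@product_measure_unique _ _ _ _ _ _ _
  (measure_function_pushforward__canonical__measure_function_Measure P mXY)) => //.
Qed.

Lemma ae_fst d1 d2 (T1 : measurableType d1) (T2 : measurableType d2)
    (R : realType) (m1 : {measure set T1 -> \bar R})
    (m2 : {sigma_finite_measure set T2 -> \bar R}) (Q : T1 -> Prop) :
  {ae m1, forall x, Q x} -> {ae (m1 \x m2)%E, forall z, Q z.1}.
Proof.
move=> [N [mN N0 QN]]; exists (N `*` setT); split.
- exact: measurableX.
(* The second factor may have infinite mass; [0 * +oo = 0] still gives a null cylinder. *)
- by rewrite product_measure1E// N0 mul0e.
- by move=> z /= Qz; split => //; exact: QN.
Qed.

Lemma ae_snd d1 d2 (T1 : measurableType d1) (T2 : measurableType d2)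
    (R : realType) (m1 : {measure set T1 -> \bar R})
    (m2 : {sigma_finite_measure set T2 -> \bar R}) (Q : T2 -> Prop) :
  {ae m2, forall y, Q y} -> {ae (m1 \x m2)%E, forall z, Q z.2}.
Proof.
move=> [N [mN N0 QN]]; exists (setT `*` N); split.
- exact: measurableX.
- by rewrite product_measure1E// N0 mule0.
- by move=> z /= Qz; split => //; exact: QN.
Qed.

Section cdf_zero_set.
Context d (T : measurableType d) (R : realType) (P : probability T R).
Variable X : {RV P >-> R}.

Lemma measurable_cdf_eq0 : measurable [set x | cdf X x = 0%E].
Proof.
have := @cdf_measurable _ _ _ _ X measurableT [set 0%E] (emeasurable_set1 _).
by rewrite setTI.
Qed.

(* The zero set is a down-set: either it has a maximum, or it is exhausted by
   the countably many half-lines ending at one of its rational points. *)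
Lemma distribution_cdf_eq0 : distribution P X [set x | cdf X x = 0%E] = 0%E.
Proof.
set S := [set x | _].
have mS : measurable S := measurable_cdf_eq0.
have Sle x y : x <= y -> S y -> S x.
  move=> xy; rewrite /S /= => y0; apply/eqP; rewrite eq_le cdf_ge0 andbT -y0.
  exact: cdf_nondecreasing.
have negl x : S x -> (distribution P X).-negligible `]-oo, x].
  by move=> Sx; apply/negligibleP.
apply: measure_negligible => //.
have [[m Sm maxm]|nomax] := pselect (exists2 m, S m & forall x, S x -> x <= m).
  by apply: negligibleS (negl _ Sm) => x /maxm; rewrite /= in_itv.
(* An enumeration of the rationals. The default 0 at invalid codes is harmless, as only those [q n]
   lying in [S] contribute below. *)
pose q n : R := if unpickle n is Some r then ratr r else 0.
apply: (@negligibleS _ _ _ _ (\bigcup_n (`]-oo, q n] `&` [set _ | S (q n)]))).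
  move=> x Sx.
  have [y Sy xy] : exists2 y, S y & x < y.
    apply: contrapT => H; apply: nomax; exists x => // y Sy.
    by rewrite leNgt; apply/negP => xy; apply: H; exists y.
  have [r] := rat_in_itvoo xy; rewrite in_itv /= => /andP[xr ry].
  exists (pickle r) => //; rewrite /q pickleK /=; split.
    by rewrite /= in_itv /= ltW.
  exact: Sle (ltW ry) Sy.
apply: negligible_bigcup => n; have [Sq|nSq] := pselect (S (q n)).
  by apply: negligibleS (negl _ Sq) => x [].
by apply: negligibleS (negligible_set0 _) => x [].
Qed.

(** The zero set of the distribution function is null for the law of [X], so the nonnegative [f] has
    integral 0 over it. *)
Lemma density_cdf_eq0 (f : R -> R) : has_density X f ->
  {ae @lebesgue_measure R, forall x, cdfR X x = 0 -> f x = 0}.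
Proof.
move=> [mf f0 fE].
set S := [set x | cdf X x = 0%E].
have mS : measurable S := measurable_cdf_eq0.
have : ae_eq (@lebesgue_measure R) S (EFin \o f) (cst 0%E).
  apply/ae_eq_integral_abs => //.
    by apply/measurable_EFinP; exact: measurable_funS mf.
  rewrite -distribution_cdf_eq0 fE//; apply: eq_integral => x _ /=.
  by rewrite ger0_norm.
apply: filterS => x fS FX0; suff: (f x)%:E = 0%E by case.
apply: fS; rewrite /S /= -[LHS]fineK ?fin_num_measure//.
by rewrite -/(cdfR X x) FX0.
Qed.

End cdf_zero_set.

Lemma independent_joint_cdf d (T : measurableType d) (R : realType)
    (P : probability T R) (X Y : {RV P >-> R}) : independent_RV X Y ->
  forall z, joint_cdf X Y z = cdfR X z.1 * cdfR Y z.2.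
Proof.
move=> XY z; rewrite /cdfR -fineM ?fin_num_measure// /cdf /distribution.
rewrite /pushforward -XY//; congr (fine (P _)).
Qed.

(* [lebesgue_measure] lives on [measurableTypeR R], whose display differs from
   that of the canonical measurable structure on [R]. *)
Definition lebesgue_RV d (T : measurableType d) (R : realType)
    (P : probability T R) (X : {RV P >-> R}) : {mfun T >-> measurableTypeR R} :=
  HB.pack (X : T -> measurableTypeR R)
    (isMeasurableFun.Build _ _ T (measurableTypeR R) X
      (measurable_funPT X : measurable_fun [set: T] (X : T -> measurableTypeR R))).

Lemma joint_density_prod d (T : measurableType d) (R : realType)
    (P : probability T R) (X Y : {RV P >-> R})
    (fXY : R * R -> R) (fX fY : R -> R) :
  independent_RV X Y -> has_joint_density X Y fXY ->
  has_density X fX -> has_density Y fY ->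
  {ae lebesgue_measure2 R, forall z, fX z.1 * fY z.2 = fXY z}.
Proof.
move=> XY hXY hX hY.
have hprod := @is_density_prod _ _ _ _ _ (@lebesgue_measure R)
  (distribution P (lebesgue_RV X)) (@lebesgue_measure R)
  (distribution P (lebesgue_RV Y)) _ _ hX hY.
have lawE := @pushforward_pair_prod _ _ _ _ _ _ _ P
  (lebesgue_RV X) (lebesgue_RV Y) XY.
apply: (is_density_ae_eq _ lawE hprod hXY).
(* The product of the laws has total mass 1, hence is finite. *)
by rewrite lawE// /pushforward preimage_setT probability_setT ltry.
Qed.

Theorem proposition3p5 (d : measure_display) (T : measurableType d)
    (R : realType) (P : probability T R) (X Y : {RV P >-> R})
    (fXY : R * R -> R) (fX fY : R -> R)
    (hindep : independent_RV X Y)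
    (hfXY : has_joint_density X Y fXY)
    (hfX : has_density X fX) (hfY : has_density Y fY) :
  {ae lebesgue_measure2 R, forall z : R * R,
    joint_iw_density X Y fXY z =
      2^-1 * (fY z.2 * iw_density X fX z.1 + fX z.1 * iw_density Y fY z.2)}.
Proof.
have fXYE := joint_density_prod hindep hfXY hfX hfY.
have fX0 : {ae lebesgue_measure2 R, forall z, cdfR X z.1 = 0 -> fX z.1 = 0}.
  exact: ae_fst (density_cdf_eq0 hfX).
have fY0 : {ae lebesgue_measure2 R, forall z, cdfR Y z.2 = 0 -> fY z.2 = 0}.
  exact: ae_snd (density_cdf_eq0 hfY).
move: fXYE fX0 fY0.
apply: (@filterS3 _ _ (ae_filter_ringOfSetsType (lebesgue_measure2 R))) => -[x y] /= fXYE fX0 fY0.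
rewrite /joint_iw_density /iw_density -fXYE independent_joint_cdf// mulf_eq0 /=.
(* The convention kills the left side and the first summand; the second vanishes through its factor
   [fX x]. *)
have [/fX0 ->|FX0] := eqVneq (cdfR X x) 0.
  by rewrite !(mul0r,mulr0,addr0).
have [/fY0 ->|FY0] := eqVneq (cdfR Y y) 0.
  by rewrite !(mul0r,mulr0,addr0).
(* Both distribution functions are now positive, so the logarithm of their product splits. *)
rewrite lnM ?posrE ?lt_neqAle ?fine_ge0 ?andbT 1?eq_sym//; ring.
Qed.
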